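(* Let $A: L^2(0,1)\to\ell^2$ be given by $[Ax]_j=\int_0^1 t^{j-1}x(t)\,dt$, $j=1,2,\dots$. For any $\mu\in(0,1)$, any constant $C>0$ and any integer $k\ge 1$, there exist functions $x$ with $$\|x\|_{H^k(0,1)}\le 1$$ such that $$\|x\|_{L^2(0,1)}\ge C\,\|Ax\|_{\ell^2}^{\mu}.$$ Consequently, for all $k=1,2,\dots$, an asymptotic bound of Hölder type $$\sup_{x\in L^2(0,1):\ \|x\|_{H^k(0,1)}\le 1,\ \|Ax\|_{\ell^2}\le\delta}\|x\|_{L^2(0,1)}=\mathcal{O}(\delta^\mu)\quad\text{as }\delta\to0$$ cannot hold even for arbitrarily small exponents $\mu>0$.
   Context: $A$ is a bounded injective linear operator from the real Hilbert space $L^2(0,1)$ to the real Hilbert space $\ell^2$ of square summable sequences indexed by $j=1,2,\dots$. $H^k(0,1)$ is the Sobolev space with norm $\|x\|_{H^k(0,1)}^2=\sum_{n=0}^k\|x^{(n)}\|_{L^2(0,1)}^2$, where $x^{(n)}$ is the $n$-th derivative. *)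

(* Defs.v *)
From HB Require Import structures.
From mathcomp Require Import all_boot all_order all_algebra.
From mathcomp Require Import all_classical all_reals all_analysis.

Set Implicit Arguments.
Unset Strict Implicit.
Unset Printing Implicit Defensive.

Import Order.TTheory GRing.Theory Num.Theory.
Import numFieldNormedType.Exports.

Local Open Scope classical_set_scope.
Local Open Scope ring_scope.

Section HausdorffMomentProblem.
Context {R : realType}.
Implicit Types (x y phi : R -> R) (u : R^nat) (k n : nat).

Definition lebesgue01 : {measure set (measurableTypeR R) -> \bar R} :=
  mrestr (@lebesgue_measure R) (measurable_itv `]0%R, 1%R[).

(* Elements of L^2(0,1) are handled through representatives defined on all of
   R; their values outside (0,1) are irrelevant. *)
Definition L2 : set (R -> R) := [set x | x \in Lfun lebesgue01 2%:E].

Definition L2norm x : \bar R := 'N[lebesgue01]_2%:E[EFin \o x]%E.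

Definition l2norm u : \bar R :=
  'N[@counting nat R]_2%:E[EFin \o u]%E.

(* Sequences are indexed from 0: [moments x i] is [Ax]_j for j = i + 1. *)
Definition moments x : R^nat := fun i => \int[lebesgue01]_t (t ^+ i * x t).

(* C^1 functions with compact support in (0,1); as in the one-dimensional
   theory of Brezis, testing against these is equivalent to testing against
   compactly supported C^oo functions. *)
Definition test_function phi : Prop :=
  [/\ forall t, derivable phi t 1, continuous (derive1 phi)
    & exists a b : R,
        [/\ 0 < a, b < 1 & forall t, ~~ (a <= t <= b) -> phi t = 0]].

Definition is_weak_derivative x y : Prop :=
  forall phi, test_function phi ->
    \int[lebesgue01]_t (x t * derive1 phi t) = - \int[lebesgue01]_t (y t * phi t).

(* Weak derivatives are unique almost everywhere, so the choice made by [xget]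
   does not affect the norms below; the value is 0 if there is no weak
   derivative in L^2(0,1), a case excluded by [Sobolev]. *)
Definition weak_derivative x : R -> R :=
  xget (cst 0) [set y | L2 y /\ is_weak_derivative x y].

Definition weak_derivative_n n x : R -> R := iter n weak_derivative x.

Definition Sobolev k : set (R -> R) :=
  [set x | L2 x /\ forall n, (n < k)%N ->
     exists2 y, L2 y & is_weak_derivative (weak_derivative_n n x) y].

(* Meaningful for x in [Sobolev k] only. *)
Definition Sobolev_norm k x : \bar R :=
  ((\sum_(n < k.+1) L2norm (weak_derivative_n n x) ^+ 2) `^ 2^-1)%E.

(* The supremum of ||x||_{L^2} over the unit ball of H^k(0,1) subject to
   ||Ax||_{l^2} <= delta. *)
Definition modulus k (delta : R) : \bar R :=
  ereal_sup [set L2norm x | x in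
    [set x | [/\ Sobolev k x, (Sobolev_norm k x <= 1)%E
               & (l2norm (moments x) <= delta%:E)%E]]].

End HausdorffMomentProblem.

(* Main.v *)
Require Import Defs.
From HB Require Import structures.
From mathcomp Require Import all_boot all_order all_algebra.
From mathcomp Require Import all_classical all_reals all_analysis.
From mathcomp Require Import measurable_realfun.
From mathcomp Require Import ring lra.

Set Implicit Arguments.
Unset Strict Implicit.
Unset Printing Implicit Defensive.

Import Order.TTheory GRing.Theory Num.Theory.
Import numFieldNormedType.Exports.

Local Open Scope classical_set_scope.
Local Open Scope ring_scope.

(* Rescaling defeats every Hoelder bound.  Let psi(s) = p((1 - s)^+), where p is
   a polynomial divisible by X^(k+1), so that psi has k continuous derivatives
   and vanishes for s >= 1, and where p is chosen by linear algebra so that the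
   moments of psi of order i < N vanish.  For x(t) = lam e^k psi(t / e) the norm
   in H^k stays bounded as e -> 0, the L^2-norm is of order at least e^(k+1),
   while the surviving moments are O(e^i) with i >= N, so ||Ax|| = O(e^N).  As N
   is arbitrary, no power of ||Ax|| controls ||x||.
   The weak derivatives selected by [weak_derivative] are those of the classical
   calculus because weak derivatives are unique almost everywhere, which follows
   from testing against bumps converging to indicator functions of intervals
   and from Lebesgue's differentiation theorem. *)

(** * Integration and square norms on the unit interval *)

Section UnitIntervalMeasure.
Context {R : realType}.
Implicit Types (f g x y : R -> R).

Local Notation nu := (@lebesgue01 R).
Local Notation leb := (@lebesgue_measure R).
Local Notation I01 := (`]0%R, 1%R[%classic : set R).

Lemma lebesgue01_setT : nu setT = 1%E.
Proof.
by rewrite /lebesgue01 /= /mrestr setTI lebesgue_measure_itv /= lte01 sube0.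
Qed.

Lemma ae_lebesgue01S (P Q : R -> Prop) : (forall t, P t -> Q t) ->
  (\forall t \ae nu, P t) -> \forall t \ae nu, Q t.
Proof.
move=> PQ; exact: (@filterS _ _ (ae_filter_ringOfSetsType nu) _ _ PQ).
Qed.

Lemma ae_lebesgue01 : \forall t \ae nu, 0 < t < 1.
Proof.
exists (~` I01); split.
- exact: measurableC.
- by rewrite /lebesgue01 /= /mrestr setICl measure0.
- by move=> t /= h; rewrite in_itv.
Qed.

Lemma ae_lebesgue01W (P : R -> Prop) :
  (forall t, 0 < t < 1 -> P t) -> \forall t \ae nu, P t.
Proof. by move=> h; exact: ae_lebesgue01S h ae_lebesgue01. Qed.

(** The two measures agree on measurable subsets of ]0, 1[, and the complement of ]0, 1[ is null for
    [nu]. *)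
Lemma integral_lebesgue01 (f : R -> \bar R) : measurable_fun setT f ->
  (\int[nu]_t f t = \int[leb]_(t in I01) f t)%E.
Proof.
move=> mf.
have -> : (\int[leb]_(t in I01) f t = \int[nu]_(t in I01) f t)%E.
  apply: eq_measure_integral => A mA AI.
  by rewrite /lebesgue01 /= /mrestr; congr (leb _); apply/esym/setIidl.
rewrite [RHS]integral_mkcond; apply: ae_eq_integral => //.
  by apply/(measurable_restrictT _ _).1 => //; exact: measurable_funS mf.
apply: ae_lebesgue01W => t t01 _.
by rewrite patchE ifT // inE /= in_itv.
Qed.

Lemma integrable_lebesgue01 (f : R -> \bar R) : measurable_fun setT f ->
  nu.-integrable setT f <-> leb.-integrable I01 f.
Proof.
move=> mf; split => /integrableP[_ fi]; apply/integrableP; split => //.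
- exact: measurable_funS mf.
- by rewrite -integral_lebesgue01 //; exact: measurableT_comp.
- by rewrite integral_lebesgue01 //; exact: measurableT_comp.
Qed.

Lemma continuous_integrable01 f : continuous f ->
  nu.-integrable setT (EFin \o f).
Proof.
move=> cf.
have mf : measurable_fun setT f by exact: continuous_measurable_fun.
apply/integrable_lebesgue01; first exact/measurable_EFinP.
have ic : leb.-integrable `[0%R, 1%R] (EFin \o f).
  apply: continuous_compact_integrable; first exact: segment_compact.
  exact: continuous_subspaceT.
by apply: integrableS ic => //; apply: subset_itv; rewrite bnd_simp.
Qed.

Lemma L2normE x : L2norm x = ((\int[nu]_t (x t ^+ 2)%:E) `^ 2^-1)%E.
Proof.
rewrite /L2norm unlock; congr (_ `^ _)%E; apply: eq_integral => t _ /=.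
by rewrite powR_mulrn // real_normK ?num_real.
Qed.

Lemma continuous_L2 f : continuous f -> L2 f.
Proof.
move=> cf.
have mf : measurable_fun setT f by exact: continuous_measurable_fun.
rewrite /L2 /= inE; apply/andP; split; rewrite inE //=.
rewrite /finite_norm -/(L2norm f) L2normE poweR_lty //.
have /integrable_lty : nu.-integrable setT (EFin \o (fun t => f t ^+ 2)).
  apply: continuous_integrable01 => t.
  apply: (@continuous_comp _ _ _ f (fun u => u ^+ 2)); first exact: cf.
  exact: exprn_continuous.
exact.
Qed.

Lemma L2_measurable x : L2 x -> measurable_fun setT x.
Proof. by rewrite /L2 /= inE => /andP[]; rewrite inE. Qed.

Lemma L2_integrableM x y : L2 x -> L2 y ->
  nu.-integrable setT (EFin \o (x \* y)).
Proof. by move=> x2 y2; apply/Lfun1_integrable/Lfun2_mul_Lfun1. Qed.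

Lemma L2norm_ge0 x : (0 <= L2norm x)%E.
Proof. exact: Lnorm_ge0. Qed.

Lemma ae_eq_L2norm x y : measurable_fun setT x -> measurable_fun setT y ->
  (\forall t \ae nu, x t = y t) -> L2norm x = L2norm y.
Proof.
move=> mx my xy; rewrite !L2normE; congr (_ `^ _)%E.
apply: ae_eq_integral => //.
- by apply/measurable_EFinP; exact: measurable_funX.
- by apply/measurable_EFinP; exact: measurable_funX.
- by move: xy; apply: ae_lebesgue01S => t -> _.
Qed.

Lemma ae_eq_Rintegral01 x y : measurable_fun setT x -> measurable_fun setT y ->
  (\forall t \ae nu, x t = y t) -> \int[nu]_t x t = \int[nu]_t y t.
Proof.
move=> mx my xy; rewrite /Rintegral; congr fine.
apply: ae_eq_integral => //; try exact/measurable_EFinP.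
by move: xy; apply: ae_lebesgue01S => t -> _.
Qed.

Lemma L2norm_le x (K : R) : measurable_fun setT x -> 0 <= K ->
  (forall t, 0 < t < 1 -> `|x t| <= K) -> (L2norm x <= K%:E)%E.
Proof.
move=> mx K0 xK; rewrite L2normE.
have -> : K%:E = ((\int[nu]_t (K ^+ 2)%:E) `^ 2^-1)%E.
  rewrite integral_cst // lebesgue01_setT mule1 poweR_EFin -[K ^+ 2]powR_mulrn //.
  by rewrite -powRrM mulfV // powRr1.
apply: gt0_ler_poweR; rewrite ?invr_ge0 // ?in_itv /= ?leey ?andbT.
- by apply: integral_ge0 => t _; rewrite lee_fin sqr_ge0.
- by apply: integral_ge0 => t _; rewrite lee_fin sqr_ge0.
apply: ae_ge0_le_integral => //.
- by move=> t _; rewrite lee_fin sqr_ge0.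
- by apply/measurable_EFinP; exact: measurable_funX.
- by move=> t _; rewrite lee_fin sqr_ge0.
- apply: ae_lebesgue01W => t t01 _.
  by rewrite lee_fin -[x t ^+ 2]real_normK ?num_real // lerXn2r ?nnegrE ?xK.
Qed.

(** The square of x dominates c^2 times the indicator function of [a, b], whose integral is c^2 (b -
    a). *)
Lemma L2norm_ge x (a b c : R) : measurable_fun setT x -> 0 <= c ->
  0 < a -> a < b -> b < 1 -> (forall t, a <= t <= b -> c <= `|x t|) ->
  ((c * Num.sqrt (b - a))%:E <= L2norm x)%E.
Proof.
move=> mx c0 a0 ab b1 xc; rewrite L2normE.
have ba0 : 0 <= b - a by rewrite subr_ge0 ltW.
have -> : (c * Num.sqrt (b - a))%:E = ((c ^+ 2 * (b - a))%:E `^ 2^-1)%E.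
  rewrite poweR_EFin powRM // ?sqr_ge0 // !powR12_sqrt ?sqr_ge0 //.
  by rewrite sqrtr_sqr ger0_norm.
have ii : (\int[nu]_t (c ^+ 2 * \1_`[a, b] t)%:E = (c ^+ 2 * (b - a))%:E)%E.
  under eq_integral do rewrite EFinM.
  rewrite ge0_integralZl_EFin ?sqr_ge0 //; last first.
    exact/measurable_EFinP/measurable_indic.
  rewrite integral_indic // setIT.
  rewrite /lebesgue01 /= /mrestr.
  rewrite (_ : `[a, b]%classic `&` _ = `[a, b]%classic); last first.
    apply/setIidl; apply: subset_itv; rewrite bnd_simp //.
  by rewrite lebesgue_measure_itv /= lte_fin ab -EFinB EFinM.
rewrite -ii.
apply: gt0_ler_poweR; rewrite ?invr_ge0 // ?in_itv /= ?leey ?andbT.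
- by apply: integral_ge0 => t _; rewrite lee_fin mulr_ge0 ?sqr_ge0.
- by apply: integral_ge0 => t _; rewrite lee_fin sqr_ge0.
apply: ge0_le_integral => //.
- by move=> t _; rewrite lee_fin mulr_ge0 ?sqr_ge0.
- by apply/measurable_EFinP/measurable_funM => //; exact: measurable_indic.
- by apply/measurable_EFinP; exact: measurable_funX.
- move=> t _; rewrite lee_fin indicE.
  case: (boolP (t \in _)) => [|_]; last by rewrite mulr0 sqr_ge0.
  rewrite inE /= in_itv /= => tab; rewrite mulr1.
  rewrite -[x t ^+ 2]real_normK ?num_real // lerXn2r ?nnegrE //.
  exact: xc.
Qed.

Lemma normr_Rintegral01_le x (K : R) : continuous x ->
  (forall t, 0 < t < 1 -> `|x t| <= K) -> `|\int[nu]_t x t| <= K.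
Proof.
move=> cx xK.
have mx : measurable_fun setT x by exact: continuous_measurable_fun.
(* The bound at the point 1/2 forces K to be nonnegative. *)
have K0 : 0 <= K.
  by apply: le_trans (normr_ge0 (x 2^-1)) (xK _ _); lra.
have ix := continuous_integrable01 cx.
apply: le_trans (le_normr_Rintegral _ ix) _ => //.
rewrite /Rintegral -[leRHS]/(fine K%:E); apply: fine_le => //.
  apply: integrable_fin_num => //.
  apply: (@continuous_integrable01 (fun t => `|x t|)) => t.
  by apply: cvg_norm; exact: cx.
apply: (@le_trans _ _ (\int[nu]_t K%:E)%E); last first.
  by rewrite integral_cst // lebesgue01_setT mule1.
apply: ae_ge0_le_integral => //.
- exact/measurable_EFinP/measurableT_comp.
- by apply: ae_lebesgue01W => t t01 _; rewrite lee_fin xK.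
Qed.

Lemma Rintegral_lebesgue01_cc x : continuous x ->
  \int[nu]_t x t = \int[leb]_(t in `[0, 1]) x t.
Proof.
move=> cx.
have mx : measurable_fun setT x by exact: continuous_measurable_fun.
have i01 : leb.-integrable `[0%R, 1%R] (EFin \o x).
  apply: continuous_compact_integrable; first exact: segment_compact.
  exact: continuous_subspaceT.
have -> : \int[nu]_t x t = \int[leb]_(t in I01) x t.
  by rewrite /Rintegral integral_lebesgue01 //; exact/measurable_EFinP.
rewrite Rintegral_itv_obnd_cbnd ?Rintegral_itv_bndo_bndc //.
- by apply: integrableS i01 => //; apply: subset_itv; rewrite bnd_simp.
- by apply: integrableS i01 => //; apply: subset_itv; rewrite bnd_simp.
Qed.

Lemma Rintegral01_FTC (F f : R -> R) : continuous f ->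
  (forall t : R, is_derive t 1 F (f t)) -> \int[nu]_t f t = F 1 - F 0.
Proof.
move=> cf dF; rewrite Rintegral_lebesgue01_cc // /Rintegral.
have cF : continuous F.
  by move=> t; apply/differentiable_continuous/derivable1_diffP.
rewrite (@continuous_FTC2 _ _ F) //.
- exact: continuous_subspaceT.
- split => //; first exact: cvg_at_right_filter (cF 0).
  exact: cvg_at_left_filter (cF 1).
- by move=> t _; rewrite derive1E derive_val.
Qed.

End UnitIntervalMeasure.

(** * Differentiability of polynomials in the positive part *)

Section PositivePart.
Context {R : realType}.
Implicit Types (f g : R -> R) (p : {poly R}).

(** For h <> 0 the difference quotient at 0 is g(h), so continuity of g at 0 gives the limit. *)
Lemma is_derive_mulid0 g : {for 0, continuous g} ->
  is_derive 0 (1 : R) (fun u => u * g u) (g 0).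
Proof.
move=> cg.
have lim : h^-1 *: ((h *: 1 + 0) * g (h *: 1 + 0) - 0 * g 0) @[h --> 0^']
    --> g 0.
  move/continuous_withinNx : cg; apply: cvg_trans.
  apply: near_eq_cvg; near=> h.
  have h0 : h != 0 by near: h; exact: nbhs_dnbhs_neq.
  by rewrite mul0r subr0 addr0 /GRing.scale /= mulr1 mulrA mulVf // mul1r.
apply: DeriveDef; first by apply/cvg_ex; exists (g 0).
by apply/cvg_lim.
Unshelve. all: by end_near.
Qed.

Lemma continuous_pos : continuous (fun u : R => Num.max 0 u).
Proof. by move=> u; apply: continuous_max; [exact: cvg_cst|exact: cvg_id]. Qed.

(** The kink of the positive part is invisible because p'(0) = 0. For u > 0 the function is locally
    p, for u < 0 it is locally constant. At 0, write p = r X + c with r(0) = 0; then p(u^+) = u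
    r(u^+) + c, and [is_derive_mulid0] applies. *)
Lemma is_derive_horner_pos p (u : R) : p`_1 = 0 ->
  is_derive u (1 : R) (fun u => p.[Num.max 0 u]) (p^`()).[Num.max 0 u].
Proof.
move=> p1; have [u0|u0] := ltP 0 u.
  rewrite ?(max_r (ltW u0)).
  apply: (near_eq_is_derive (f := horner p)).
  near=> t; rewrite max_r //; apply: ltW; near: t; exact: lt_nbhsr.
rewrite horner_coef0 coef_deriv p1 mul0rn.
move: u0; rewrite le_eqVlt => /predU1P[->|u0]; last first.
  apply: (near_eq_is_derive (f := cst p.[0])).
  near=> t; rewrite max_l //; apply: ltW; near: t; exact: lt_nbhsl.
elim/poly_ind: p p1 => [_|r c _].
  under eq_fun do rewrite horner0; exact: is_derive_cst.
rewrite coefD coefMX coefC /= addr0 => r0.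
have -> : (fun u => (r * 'X + c%:P).[Num.max 0 u]) =
    (fun u => u * r.[Num.max 0 u]) + cst c.
  apply/funext => t; rewrite /= /GRing.add /= !hornerE /=.
  have [t0|t0] := ltP 0 t; first by rewrite mulrC.
  by rewrite horner_coef0 r0 !mulr0.
rewrite -[X in is_derive _ _ _ X]addr0.
apply: is_deriveD.
rewrite -[X in is_derive _ _ _ X](_ : r.[Num.max 0 0] = 0); last first.
  by rewrite maxxx horner_coef0 r0.
apply: (@is_derive_mulid0 (fun u => r.[Num.max 0 u])).
apply: (@continuous_comp _ _ _ (fun u : R => Num.max 0 u) (horner r)).
  exact: continuous_pos.
exact: continuous_horner.
Unshelve. all: by end_near.
Qed.
End PositivePart.

(** * Classical derivatives as weak derivatives, and a family of test functions *)

Section WeakDerivative.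
Context {R : realType}.
Implicit Types (f g x y phi : R -> R).

Lemma derivable_continuous f : (forall t : R, derivable f t 1) -> continuous f.
Proof. by move=> df t; apply/differentiable_continuous/derivable1_diffP. Qed.

Lemma test_function_continuous phi : test_function phi -> continuous phi.
Proof. by case=> /derivable_continuous. Qed.

Lemma continuous_mul f g : continuous f -> continuous g -> continuous (f \* g).
Proof. by move=> cf cg t; apply: continuousM; [exact: cf|exact: cg]. Qed.

(** Integration by parts: f phi vanishes at 0 and 1, so its derivative f phi' + g phi has integral
    0. *)
Lemma is_weak_derivative_classical f g : continuous g ->
  (forall t : R, is_derive t 1 f (g t)) -> is_weak_derivative f g.
Proof.
move=> cg df phi tphi; have cphi := test_function_continuous tphi.
case: tphi => dphi cdphi [a [b [a0 b1 sphi]]].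
have cf : continuous f by apply: derivable_continuous => t; have [] := df t.
have dfphi (t : R) : is_derive t 1 (f \* phi) (f t * derive1 phi t + g t * phi t).
  have dphit : is_derive t 1 phi (derive1 phi t).
    by apply: DeriveDef => //; rewrite derive1E.
  have := is_deriveM (df t) dphit.
  by rewrite /GRing.scale /= [phi t * _]mulrC.
have phi0 : phi 0 = 0 by apply: sphi; rewrite negb_and -ltNge a0.
have phi1 : phi 1 = 0 by apply: sphi; rewrite negb_and -!ltNge b1 orbT.
have := @Rintegral01_FTC _ (f \* phi) (f \* derive1 phi \+ g \* phi) _ dfphi.
rewrite /= phi0 phi1 !mulr0 subr0 RintegralD //.
- move=> /(_ _)/eqP; rewrite addr_eq0 => h; apply/eqP/h => t.
  by apply: continuousD; apply: continuous_mul.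
- by apply: continuous_integrable01; exact: continuous_mul.
- by apply: continuous_integrable01; exact: continuous_mul.
Qed.

(* The C^1 bumps n v / (1 + n v), where v is the square of the positive part of
   (t - a)(b - t), increase to the indicator function of ]a, b[. *)
Definition bump (a b : R) (n : nat) : R -> R :=
  fun t => 1 - (1 + n.+1%:R * (Num.max 0 ((t - a) * (b - t))) ^+ 2)^-1.

(** The bump is C^1 thanks to the square: X^2 has no linear term, so [is_derive_horner_pos]
    differentiates the squared positive part. *)
Lemma test_function_bump a b n : 0 < a -> a < b -> b < 1 ->
  test_function (bump a b n).
Proof.
move=> a0 ab b1.
pose q : {poly R} := ('X - a%:P) * (b%:P - 'X).
pose v := fun t => 1 + n.+1%:R * (Num.max 0 q.[t]) ^+ 2.
have bumpE : bump a b n = fun t => 1 - (v t)^-1.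
  by apply/funext => t; rewrite /bump /v /q !hornerE.
have v0 t : v t != 0.
  by rewrite gt_eqF // /v ltr_wpDr // mulr_ge0 ?ler0n // sqr_ge0.
pose dv := fun t => n.+1%:R * (2 * Num.max 0 q.[t] * (deriv q).[t]).
have dvP (t : R) : is_derive t 1 v (dv t).
  have dp : is_derive q.[t] (1 : R) (fun u => (Num.max 0 u) ^+ 2)
      (2 * Num.max 0 q.[t]).
    have := @is_derive_horner_pos R 'X^2 q.[t].
    rewrite coefXn derivXn /= hornerMn hornerX mulr_natl => /(_ erefl).
    by under eq_fun do rewrite hornerXn.
  have dc := is_derive1_comp dp (is_derive_poly q t).
  have dm := is_deriveZ n.+1%:R dc.
  have := is_deriveD (is_derive_cst (1 : R) t 1) dm.
  by rewrite add0r.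
have dbump (t : R) : is_derive t 1 (bump a b n) ((v t)^-1 ^+ 2 * dv t).
  rewrite bumpE.
  have dV := is_deriveV (v0 t) (dvP t).
  have := is_deriveB (is_derive_cst (1 : R) t 1) dV.
  by rewrite sub0r scaleNr opprK exprVn.
have cv : continuous v by apply: derivable_continuous => t; have [] := dvP t.
split.
- by move=> t; have [] := dbump t.
- have -> : derive1 (bump a b n) = (fun t => (v t)^-1 ^+ 2) \* dv.
    by apply/funext => t; rewrite derive1E derive_val.
  apply: continuous_mul.
    have cV : continuous (fun t => (v t)^-1).
      by move=> t; apply: cvgV => //; exact: cv.
    exact: (continuous_mul cV cV).
  apply: (@continuous_mul (cst n.+1%:R)); first by move=> t; exact: cvg_cst.
  apply: (@continuous_mul (fun t => 2 * Num.max 0 q.[t])); last first.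
    exact: continuous_horner.
  apply: (@continuous_mul (cst 2)); first by move=> t; exact: cvg_cst.
  move=> t; apply: (@continuous_comp _ _ _ (horner q) (fun u => Num.max 0 u)).
    exact: continuous_horner.
  exact: continuous_pos.
- exists a, b; split => // t; rewrite negb_and -!ltNge => tab.
  rewrite /bump max_l ?expr0n ?mulr0 ?addr0 ?invr1 ?subrr //.
  case/orP: tab => tab; nra.
Qed.

End WeakDerivative.

(** * The fundamental lemma of the calculus of variations *)

Section FundamentalLemma.
Context {R : realType}.
Implicit Types (f g x y phi : R -> R).

Local Notation nu := (@lebesgue01 R).
Local Notation leb := (@lebesgue_measure R).
Local Notation I01 := (`]0%R, 1%R[%classic : set R).

Lemma bump_itv (a b : R) n t : 0 <= bump a b n t <= 1.
Proof.
rewrite /bump; set w := n.+1%:R * _.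
have w0 : 0 <= w by rewrite mulr_ge0 ?ler0n ?sqr_ge0.
have w1 : 0 < 1 + w by rewrite ltr_wpDr.
rewrite subr_ge0 invf_le1 // lerDl w0 /= gerBl invr_ge0; exact: ltW.
Qed.

(** Outside ]a, b[ every bump vanishes at t. Inside, with c > 0 the squared positive part at t, the
    defect from 1 is at most 1 / (c (n + 1)). *)
Lemma cvg_bump (a b t : R) : a < b ->
  bump a b n t @[n --> \oo] --> (\1_`]a, b[ t : R).
Proof.
move=> ab; pose c := Num.max 0 ((t - a) * (b - t)) ^+ 2.
have [c0|c0] := eqVneq c 0.
  have -> : bump a b ^~ t = cst 0.
    by apply/funext => n; rewrite /bump -/c c0 mulr0 addr0 invr1 subrr.
  rewrite indicE memNset; first exact: cvg_cst.
  rewrite /= in_itv /= => /andP[at_ tb].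
  move/eqP: c0; rewrite sqrf_eq0 max_r; first by rewrite mulf_eq0 !subr_eq0 !gt_eqF.
  by rewrite mulr_ge0 // subr_ge0 ltW.
have key n (d : R) : 0 < d ->
    0 <= (1 + n.+1%:R * d)^-1 <= d^-1 * harmonic n.
  move=> d0; have nd0 : 0 < n.+1%:R * d by rewrite mulr_gt0.
  have nd1 : 0 < 1 + n.+1%:R * d by rewrite addr_gt0.
  rewrite invr_ge0 (ltW nd1) /= /harmonic -invfM [d * _]mulrC.
  by rewrite lef_pV2 ?posrE // lerDr.
have c0' : 0 < c by rewrite lt_def c0 /c sqr_ge0.
have -> : \1_`]a, b[ t = 1 - 0 :> R.
  rewrite subr0 indicE mem_set //= in_itv /=.
  apply: contraNT c0 => tab; rewrite /c max_l ?expr0n //.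
  by move: tab; rewrite negb_and -!leNgt => /orP[] tab; nra.
apply: cvgB; first exact: cvg_cst.
apply: (@squeeze_cvgr _ _ _ _ (cst 0) (fun n => c^-1 * harmonic n)).
- by apply: nearW => n; exact: key.
- exact: cvg_cst.
- rewrite -[X in _ --> X](mulr0 c^-1); apply: cvgM; first exact: cvg_cst.
  exact: cvg_harmonic.
Qed.

(** Dominated convergence along the bumps of ]a, b[, with |y| as dominating function. *)
Lemma itv_integral0 y (a b : R) : nu.-integrable setT (EFin \o y) ->
  (forall phi, test_function phi -> \int[nu]_t (y t * phi t) = 0) ->
  0 < a -> a < b -> b < 1 -> \int[leb]_(t in `]a, b[) y t = 0.
Proof.
move=> iy y0 a0 ab b1.
have my : measurable_fun setT y by apply/measurable_EFinP; case/integrableP: iy.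
have mi : measurable_fun setT (\1_`]a, b[ : R -> R) by exact: measurable_indic.
have myi : measurable_fun setT (fun t => y t * \1_`]a, b[ t).
  exact: measurable_funM.
have -> : \int[leb]_(t in `]a, b[) y t = \int[nu]_t (y t * \1_`]a, b[ t).
  rewrite /Rintegral integral_lebesgue01; last exact/measurable_EFinP.
  congr fine.
  have abE : `]a, b[%classic = I01 `&` `]a, b[%classic.
    apply/esym/setIidr; apply: subset_itv; rewrite bnd_simp; exact: ltW.
  rewrite [in LHS]abE integral_mkcondr; apply: eq_integral => t _.
  rewrite patchE indicE; case: (t \in _) => /=; rewrite ?mulr1 ?mulr0; reflexivity.
have mf n : measurable_fun setT (EFin \o (fun t => y t * bump a b n t)).
  apply/measurable_EFinP/measurable_funM => //.
  apply: continuous_measurable_fun; apply: test_function_continuous.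
  exact: test_function_bump.
(* The hypothesis concerns only the [fine] part of the integral; integrability excludes an infinite
   value. *)
have iyb n : (\int[nu]_t (y t * bump a b n t)%:E = 0)%E.
  rewrite -[LHS]fineK.
    by have := y0 _ (test_function_bump n a0 ab b1); rewrite /Rintegral => ->.
  apply: integrable_fin_num => //.
  apply: (le_integrable measurableT _ _ iy); first exact: mf.
  move=> t _ /=.
  have /andP[p0 p1] := bump_itv a b n t.
  by rewrite lee_fin normrM (ger0_norm p0) ler_piMr.
have [||||_ _ lim] := @dominated_convergence _ _ _ nu setT measurableT
  (fun n => EFin \o (fun t => y t * bump a b n t))
  (EFin \o (fun t => y t * \1_`]a, b[ t)) (EFin \o (fun t => `|y t|)) mf.
- exact/measurable_EFinP.
- apply: aeW => t _; apply: cvg_EFin; first exact: nearW.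
  by apply: cvgM; [exact: cvg_cst|exact: cvg_bump].
- exact: integrable_abse iy.
- apply: aeW => t n _ /=; rewrite lee_fin normrM ler_piMr //.
  by have /andP[p0 p1] := bump_itv a b n t; rewrite ger0_norm.
rewrite /Rintegral -[RHS]/(fine 0%E); congr fine.
apply: (@cvg_unique _ (@ereal_hausdorff R) _ _ _ _ lim).
rewrite (_ : [sequence _]_n = cst 0%E); first exact: cvg_cst.
by apply/funext => n /=; rewrite iyb.
Qed.

(** By [itv_integral0], the indefinite integral of y started at 1/(n + 2) vanishes up to 1, while by
    Lebesgue's differentiation theorem its derivative is y almost everywhere. The starting point
    must be positive for the bumps to be test functions; countably many of them exhaust ]0, 1[. *)
Lemma ae_eq0_test_function y : nu.-integrable setT (EFin \o y) ->
  (forall phi, test_function phi -> \int[nu]_t (y t * phi t) = 0) ->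
  \forall t \ae nu, y t = 0.
Proof.
move=> iy y0.
have my : measurable_fun setT y by apply/measurable_EFinP; case/integrableP: iy.
have iy1 : leb.-integrable I01 (EFin \o y).
  by apply/integrable_lebesgue01 => //; exact/measurable_EFinP.
(* Extending y by zero makes it integrable on the whole line, the setting of [FTC1]. *)
pose f := y \_ I01.
have fi : leb.-integrable setT (EFin \o f).
  rewrite /f -restrict_EFin; apply/integrable_restrict => //=.
  by rewrite setTI.
have flocal : locally_integrable [set: R] f.
  exact: integrable_locally_restrict.
have ft n : {ae leb, forall t, n.+2%:R^-1 < t < 1 -> y t = 0}.
  have fii u : leb.-integrable
      [set` Interval (BRight n.+2%:R^-1) (BRight u)] (EFin \o f).
    by apply: integrableS fi.
  have := FTC1 fii flocal.
  apply: (@filterS _ _ (ae_filter_ringOfSetsType leb)) => t /= h /andP[tn t1].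
  have {h} [|_ h] := h; first by [].
  have <- : f t = y t.
    rewrite /f patchE ifT // inE /= in_itv /= t1 andbT.
    by apply: lt_trans tn; rewrite invr_gt0.
  rewrite -h derive1E.
  rewrite (near_eq_derive (g := cst 0)) ?derive_cst //.
  near=> u.
  have un : n.+2%:R^-1 < u by near: u; exact: lt_nbhsr.
  have u1 : u < 1 by near: u; exact: lt_nbhsl.
  rewrite /cst -Rintegral_itv_bndo_bndc; last by apply: integrableS fi.
  rewrite -[RHS](@itv_integral0 y n.+2%:R^-1 u) // ?invr_gt0 //.
  apply: eq_Rintegral => s; rewrite inE /= in_itv /= => /andP[ns su].
  rewrite /f patchE ifT // inE /= in_itv /= (lt_trans su u1) andbT.
  by apply: lt_trans ns; rewrite invr_gt0.
have /ae_foralln[N [mN N0 NS]] := ft.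
exists (N `|` ~` I01); split.
- exact/measurableU/measurableC.
- rewrite /lebesgue01 /= /mrestr setIUl setICl setU0.
  by apply: subset_measure0 N0 => //; exact: measurableI.
- move=> t /= yt; have [tI|] := pselect (I01 t); last by right.
  left; apply: NS => /= ytn; apply: yt.
  move: tI; rewrite /= in_itv /= => /andP[t0 t1].
  have [k] := ltr_add_invr t0; rewrite add0r => kt.
  apply: (ytn k); rewrite t1 andbT; apply: lt_trans kt.
  by rewrite ltf_pV2 ?posrE // ltr_nat.
Unshelve. all: by end_near.
Qed.

End FundamentalLemma.

(** * Sobolev norms of classically differentiable functions *)

Section SobolevClassical.
Context {R : realType}.
Implicit Types (f g x y phi : R -> R).

Local Notation nu := (@lebesgue01 R).

Lemma L2_integrable x : L2 x -> nu.-integrable setT (EFin \o x).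
Proof.
move=> x2; apply/Lfun1_integrable; apply: Lfun_subset12 => //.
by rewrite lebesgue01_setT.
Qed.

Lemma is_weak_derivative_unique x y z : L2 y -> L2 z ->
  is_weak_derivative x y -> is_weak_derivative x z ->
  \forall t \ae nu, y t = z t.
Proof.
move=> y2 z2 xy xz.
have h : \forall t \ae nu, (y \- z) t = 0.
  apply: ae_eq0_test_function => [|phi tphi].
    exact: (integrableB measurableT (L2_integrable y2) (L2_integrable z2)).
  have phi2 : L2 phi by apply: continuous_L2; exact: test_function_continuous.
  under eq_Rintegral do rewrite /= mulrBl.
  rewrite RintegralB //; try exact: L2_integrableM.
  by apply/eqP; rewrite subr_eq0 -eqr_opp -(xy _ tphi) -(xz _ tphi).
by move: h; apply: ae_lebesgue01S => t /eqP; rewrite subr_eq0 => /eqP.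
Qed.

(** Each application of [weak_derivative] returns an arbitrary representative, so iterating it
    requires passing between almost everywhere equal functions. *)
Lemma ae_eq_is_weak_derivative x x' y :
  measurable_fun setT x -> measurable_fun setT x' ->
  (\forall t \ae nu, x t = x' t) ->
  is_weak_derivative x y -> is_weak_derivative x' y.
Proof.
move=> mx mx' xx' xy phi tphi; rewrite -xy //.
have mphi : measurable_fun setT (derive1 phi).
  by case: tphi => _ cphi _; exact: continuous_measurable_fun.
apply: ae_eq_Rintegral01; try exact: measurable_funM.
by move: xx'; apply: ae_lebesgue01S => t ->.
Qed.

Lemma weak_derivativeP x y : L2 y -> is_weak_derivative x y ->
  [/\ L2 (weak_derivative x), is_weak_derivative x (weak_derivative x)
    & \forall t \ae nu, weak_derivative x t = y t].
Proof.
move=> y2 xy.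
have [w2 xw] : [set y | L2 y /\ is_weak_derivative x y] (weak_derivative x).
  by apply: xgetPex; exists y.
by split=> //; exact: is_weak_derivative_unique xw xy.
Qed.

Section Tower.
Variables (k : nat) (F : nat -> R -> R).
Hypothesis contF : forall n, (n <= k)%N -> continuous (F n).
Hypothesis deriveF :
  forall n, (n < k)%N -> forall t : R, is_derive t 1 (F n) (F n.+1 t).

(** By induction, the selected n-th derivative is almost everywhere [F n], hence has [F n.+1] as a
    weak derivative, and uniqueness identifies the next selection. *)
Lemma weak_derivative_n_classical n : (n <= k)%N ->
  L2 (weak_derivative_n n (F 0)) /\
  \forall t \ae nu, weak_derivative_n n (F 0) t = F n t.
Proof.
elim: n => [_|n IHn nk].
  by split; [exact/continuous_L2/contF|exact: aeW].
have [w2 wF] := IHn (ltnW nk).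
have FF : is_weak_derivative (F n) (F n.+1).
  by apply: is_weak_derivative_classical; [exact: contF|exact: deriveF].
have F2 : L2 (F n.+1) by exact/continuous_L2/contF.
have FL2 : L2 (F n) by exact/continuous_L2/contF/ltnW.
have wd : is_weak_derivative (weak_derivative_n n (F 0)) (F n.+1).
  apply: ae_eq_is_weak_derivative FF; try exact: L2_measurable.
  by move: wF; apply: ae_lebesgue01S => t ->.
by have [? _ ?] := weak_derivativeP F2 wd.
Qed.

Lemma Sobolev_classical : Sobolev k (F 0).
Proof.
split; first by apply: continuous_L2; exact: contF.
move=> n nk; exists (F n.+1); first by apply: continuous_L2; exact: contF.
have [w2 wF] := weak_derivative_n_classical (ltnW nk).
apply: (@ae_eq_is_weak_derivative (F n)).
- by apply: L2_measurable; apply: continuous_L2; exact/contF/ltnW.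
- exact: L2_measurable.
- by move: wF; apply: ae_lebesgue01S => t ->.
- by apply: is_weak_derivative_classical; [exact: contF|exact: deriveF].
Qed.

Lemma Sobolev_norm_classical_le1 (K : R) : 0 <= K -> k.+1%:R * K ^+ 2 <= 1 ->
  (forall n t, (n <= k)%N -> 0 < t < 1 -> `|F n t| <= K) ->
  (Sobolev_norm k (F 0) <= 1)%E.
Proof.
move=> K0 K1 FK.
have h : (\sum_(n < k.+1) L2norm (weak_derivative_n n (F 0)) ^+ 2 <= 1)%E.
  apply: (@le_trans _ _ (\sum_(n < k.+1) (K ^+ 2)%:E)%E).
    apply: lee_sum => n _.
    have nk : (n <= k)%N by rewrite -ltnS.
    have [w2 wF] := weak_derivative_n_classical nk.
    have mF : measurable_fun setT (F n).
      by apply: L2_measurable; apply: continuous_L2; exact: contF.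
    rewrite (ae_eq_L2norm _ mF wF); last exact: L2_measurable.
    have FKn : (L2norm (F n) <= K%:E)%E by apply: L2norm_le => // t; exact: FK.
    by rewrite EFin_expe lee_sqr ?L2norm_ge0.
  rewrite sumEFin lee_fin sumr_const card_ord -mulr_natl; exact: K1.
rewrite /Sobolev_norm -[leRHS](poweR1r 2^-1).
apply: gt0_ler_poweR => //; rewrite in_itv /= leey andbT //.
by apply: sume_ge0 => n _; exact: sqre_ge0.
Qed.

End Tower.
End SobolevClassical.

(** * Scaled profiles and their moments *)

Section ScaledProfile.
Context {R : realType}.
Implicit Types (p : {poly R}) (e t : R).

Local Notation nu := (@lebesgue01 R).

(** With this function, [p.[hat e t]] is the rescaled profile psi(t / e). *)
Definition hat e t : R := Num.max 0 (1 - t / e).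

Lemma continuous_horner_hat p e : continuous (fun t => p.[hat e t]).
Proof.
move=> t; apply: (@continuous_comp _ _ _ (hat e) (horner p)); last first.
  exact: continuous_horner.
apply: (@continuous_comp _ _ _ (fun t => 1 - t / e) (fun u => Num.max 0 u)).
  apply: continuousB; first exact: cvg_cst.
  by apply: continuousM => //; exact: cvg_cst.
exact: continuous_pos.
Qed.

Lemma is_derive_horner_hat p e t : p`_1 = 0 ->
  is_derive t (1 : R) (fun t => p.[hat e t]) (- e^-1 * (deriv p).[hat e t]).
Proof.
move=> p1.
pose q : {poly R} := 1 - e^-1 *: 'X.
have qE s : q.[s] = 1 - s / e by rewrite /q !hornerE mulrC.
have dq : deriv q = (- e^-1)%:P.
  by rewrite /q derivB derivZ derivX derivC sub0r alg_polyC polyCN.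
have := is_derive1_comp (is_derive_horner_pos q.[t] p1) (is_derive_poly q t).
rewrite dq hornerC mulrC qE /comp.
by under eq_fun do rewrite qE.
Qed.

Lemma hat_ge0 e t : 0 <= hat e t.
Proof. by rewrite /hat le_max lexx. Qed.

Lemma hat_le1 e t : 0 < e -> 0 <= t -> hat e t <= 1.
Proof. by move=> e0 t0; rewrite /hat ge_max ler01 gerBl divr_ge0 // ltW. Qed.

Lemma hat_eq0 e t : 0 < e -> e <= t -> hat e t = 0.
Proof.
by move=> e0 et; rewrite /hat max_l // subr_le0 ler_pdivlMr // mul1r.
Qed.

Lemma hatE e t : 0 < e -> t <= e -> hat e t = 1 - t / e.
Proof.
by move=> e0 te; rewrite /hat max_r // subr_ge0 ler_pdivrMr // mul1r.
Qed.

(** On t <= e one has t = e (1 - [hat e t]); beyond e both sides vanish, as all the exponents are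
    positive. *)
Lemma mul_hat_expr e t m : 0 < e ->
  t * hat e t ^+ m.+1 = e * (hat e t ^+ m.+1 - hat e t ^+ m.+2).
Proof.
move=> e0; have [te|te] := leP t e; last first.
  by rewrite (hat_eq0 e0 (ltW te)) !expr0n /= subrr !mulr0.
have tE : t = e * (1 - hat e t).
  by rewrite hatE // opprB addrCA subrr addr0 mulrCA divff ?gt_eqF // mulr1.
by rewrite {1}tE -mulrA mulrBl mul1r -exprS.
Qed.

(* The Beta integral of s^i (1 - s)^m over (0,1); the recursion comes from
   s^(i+1) (1 - s)^m = s^i (1 - s)^m - s^i (1 - s)^(m+1). *)
Fixpoint hat_moment (i m : nat) : R :=
  if i is j.+1 then hat_moment j m - hat_moment j m.+1 else m.+1%:R^-1.

Lemma continuous_expr_hat i m e : continuous (fun t => t ^+ i * hat e t ^+ m).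
Proof.
have := @continuous_horner_hat 'X^m e.
under eq_fun do rewrite hornerXn.
apply: continuous_mul; exact: exprn_continuous.
Qed.

(** Induction on i, trading a factor t for powers of [hat] by [mul_hat_expr]. The scale e enters
    only through e^(i+1), so moments that cancel at one scale cancel at all. *)
Lemma Rintegral_expr_hat i m e : 0 < e -> e <= 1 ->
  \int[nu]_t (t ^+ i * hat e t ^+ m.+1) = hat_moment i m.+1 * e ^+ i.+1.
Proof.
move=> e0 e1; elim: i m => [m|i IHi m].
  have cm := @continuous_expr_hat 0 m.+1 e.
  (* For i = 0, an antiderivative of the power m + 1 of [hat] is -e/(m + 2) times its power m +
     2. *)
  have dF (t : R) : is_derive t 1
      (fun t => (- e / m.+2%:R) * ('X^(m.+2) : {poly R}).[hat e t])
      (t ^+ 0 * hat e t ^+ m.+1).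
    have X1 : ('X^(m.+2) : {poly R})`_1 = 0 by rewrite coefXn.
    have := is_deriveZ (- e / m.+2%:R) (@is_derive_horner_hat 'X^(m.+2) e t X1).
    rewrite derivXn /= hornerMn hornerXn /GRing.scale /= -mulr_natl => h.
    apply: is_derive_eq.
    have e00 : e != 0 by rewrite gt_eqF.
    by rewrite expr0; field; rewrite e00 -natrD pnatr_eq0.
  rewrite (Rintegral01_FTC cm dF) hat_eq0 // hatE // ?ltW // !hornerXn.
  by rewrite mul0r subr0 expr1n expr0n /= mulr0 sub0r mulr1 mulNr opprK mulrC.
under eq_Rintegral do rewrite exprSr -mulrA mul_hat_expr // mulrCA mulrBr.
rewrite RintegralZl //; last first.
  apply: (@continuous_integrable01 _ (fun t =>
    t ^+ i * hat e t ^+ m.+1 - t ^+ i * hat e t ^+ m.+2)) => t.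
  by apply: cvgB; exact: continuous_expr_hat.
rewrite RintegralB //; try exact/continuous_integrable01/continuous_expr_hat.
by rewrite !IHi -mulrBl mulrCA -exprS.
Qed.

Lemma Rintegral01_sum (I : Type) (r : seq I) (f : I -> R -> R) :
  (forall i, continuous (f i)) ->
  \int[nu]_t (\sum_(i <- r) f i t) = \sum_(i <- r) \int[nu]_t f i t.
Proof.
move=> cf; elim: r => [|i r IHr].
  under eq_Rintegral do rewrite big_nil.
  by rewrite big_nil Rintegral_cst // mul0r.
have cr : continuous (fun t => \sum_(j <- r) f j t).
  elim: r {IHr} => [|j r IHr] t.
    by under eq_fun do rewrite big_nil; exact: cvg_cst.
  under eq_fun do rewrite big_cons.
  by apply: continuousD; [exact: cf|exact: IHr].
under eq_Rintegral do rewrite big_cons.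
rewrite RintegralD //; try exact: continuous_integrable01.
by rewrite big_cons IHr.
Qed.

End ScaledProfile.

(** * Construction of the profile, and bounds for polynomials and sequences *)

Section Profile.
Context {R : realType}.
Implicit Types (p : {poly R}) (e t y : R).

Local Notation nu := (@lebesgue01 R).

(** These are N homogeneous linear equations in N + 1 unknowns. The unknown of index j is the
    coefficient of the power j + k + 1 of [hat]. *)
Lemma exists_vanishing_moments (k N : nat) : exists v : 'rV[R]_N.+1,
  v != 0 /\ forall i, (i < N)%N -> \sum_j v 0 j * hat_moment i (j + k).+1 = 0.
Proof.
pose A : 'M[R]_(N.+1, N) := \matrix_(j, i) hat_moment i (j + k).+1.
have : kermx A != 0.
  by rewrite kermx_eq0 /row_free neq_ltn ltnS rank_leq_col.
case/rowV0Pn => v /sub_kermxP vA v0; exists v; split => // i iN.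
have := congr1 (fun B : 'rV_N => B 0 (Ordinal iN)) vA.
rewrite !mxE => h; rewrite -[RHS]h.
by apply: eq_bigr => j _; rewrite mxE.
Qed.

Lemma horner_rVpoly_mulXn n (v : 'rV[R]_n) k y :
  (rVpoly v * 'X^k).[y] = \sum_j v 0 j * y ^+ (j + k).
Proof.
rewrite hornerM hornerXn horner_poly mulr_suml; apply: eq_bigr => j _.
by rewrite exprD mulrA; case: insubP => [u _ /val_inj ->|]; rewrite ?ltn_ord.
Qed.

Lemma exists_profile (k N : nat) : exists p,
  [/\ p != 0, forall i, (i <= k)%N -> p`_i = 0
    & forall i e, (i < N)%N -> 0 < e -> e <= 1 ->
        \int[nu]_t (t ^+ i * p.[hat e t]) = 0].
Proof.
have [v [v0 vm]] := exists_vanishing_moments k N.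
(* The factor X^(k+1) supplies the smoothness at the kink, and v the vanishing moments. *)
exists (rVpoly v * 'X^(k.+1)); split.
- rewrite mulf_neq0 //; last by rewrite monic_neq0 ?monicXn.
  by apply: contra_neq v0 => v0; rewrite -(rVpolyK v) v0 linear0.
- by move=> i ik; rewrite coefMXn ltnS ik.
move=> i e iN e0 e1.
under eq_Rintegral do rewrite horner_rVpoly_mulXn mulr_sumr.
rewrite Rintegral01_sum; last first.
  move=> j t; under eq_fun do rewrite mulrCA.
  by apply: cvgM; [exact: cvg_cst|exact: continuous_expr_hat].
rewrite (eq_bigr (fun j => v 0 j * hat_moment i (j + k).+1 * e ^+ i.+1)).
  by rewrite -mulr_suml vm // mul0r.
move=> j _; under eq_Rintegral do rewrite mulrCA addnS.
rewrite RintegralZl // ?Rintegral_expr_hat ?mulrA //.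
exact/continuous_integrable01/continuous_expr_hat.
Qed.

Lemma horner_bounded01 p : exists2 K, 0 < K & forall y, 0 <= y <= 1 -> `|p.[y]| <= K.
Proof.
exists (1 + \sum_(i < size p) `|p`_i|).
  by rewrite ltr_wpDr // sumr_ge0.
move=> y /andP[y0 y1]; rewrite horner_coef.
apply: le_trans (ler_norm_sum _ _ _) _.
rewrite ler_wpDl // ler_sum // => i _.
by rewrite normrM ler_piMr // normrX (ger0_norm y0) exprn_ile1.
Qed.

Lemma derivn_bounded01 p k : exists2 K, 0 < K &
  forall n y, (n <= k)%N -> 0 <= y <= 1 -> `|(derivn n p).[y]| <= K.
Proof.
elim: k => [|k [K K0 IHk]].
  have [K K0 pK] := horner_bounded01 p; exists K => // n y.
  by rewrite leqn0 => /eqP -> /pK; rewrite derivn0.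
have [K' K'0 pK'] := horner_bounded01 (derivn k.+1 p).
exists (K + K') => [|n y]; first exact: addr_gt0.
rewrite leq_eqVlt => /predU1P[->|nk] y01.
  by apply: le_trans (pK' _ y01) _; rewrite lerDr ltW.
by apply: le_trans (IHk _ _ nk y01) _; rewrite lerDl ltW.
Qed.

(** A nonzero polynomial has fewer than [size p] roots, so one of the [size p] points 1/(n + 2) is
    not a root; continuity gives an interval around it. *)
Lemma horner_away0 p : p != 0 -> exists a b c,
  [/\ 0 < a, a < b, b < 1, 0 < c & forall y, a <= y <= b -> c <= `|p.[y]|].
Proof.
move=> p0.
have [y /andP[y0 y1] py] : exists2 y, 0 < y < 1 & p.[y] != 0.
  apply: contrapT => h.
  pose rs := [seq n.+2%:R^-1 : R | n <- iota 0 (size p)].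
  have := @max_poly_roots _ p rs p0; rewrite size_map size_iota ltnn => H.
  suff : false by []; apply: H.
    apply/allP => _ /mapP[n _ ->]; apply/rootP; apply: contrapT => /eqP pn.
    apply: h; exists n.+2%:R^-1 => //.
    by rewrite invr_gt0 ltr0n /= invf_lt1 ?ltr1n // ltr0n.
  rewrite map_inj_uniq ?iota_uniq // => m n /invr_inj /eqP.
  by rewrite eqr_nat => /eqP[].
pose c := `|p.[y]| / 2.
have c0 : 0 < c by rewrite divr_gt0 // normr_gt0.
have : \forall z \near y, c <= `|p.[z]|.
  have cp : (fun z => `|p.[z]|) @ y --> `|p.[y]|.
    by apply: cvg_norm; exact: continuous_horner.
  have := cvgr_ge _ cp; apply.
  by rewrite /c ltr_pdivrMr // ltr_pMr ?normr_gt0 // ltr1n.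
case=> r /= r0 yr.
(* The halves keep the closed interval [y - d, y + d] inside both the ball of radius r and ]0,
   1[. *)
pose d := Num.min (r / 2) (Num.min (y / 2) ((1 - y) / 2)).
have d0 : 0 < d by rewrite !lt_min !divr_gt0 // subr_gt0.
have [dr dy d1] : [/\ d < r, d < y & d < 1 - y].
  split; rewrite /d !gt_min.
  - by apply/orP; left; lra.
  - by apply/orP; right; apply/orP; left; lra.
  - by apply/orP; right; apply/orP; right; lra.
exists (y - d), (y + d), c; split => //; try lra.
move=> z /andP[z1 z2]; apply: yr => /=.
rewrite (@le_lt_trans _ _ d) // ler_norml; lra.
Qed.

Lemma geometric_half_sum n : \sum_(0 <= i < n) (2^-1 : R) ^+ i <= 2.
Proof.
suff -> : \sum_(0 <= i < n) (2^-1 : R) ^+ i = 2 - 2 * 2^-1 ^+ n.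
  by rewrite gerBl mulr_ge0 // exprn_ge0 // invr_ge0.
elim: n => [|n IHn]; first by rewrite big_geq // expr0 mulr1 subrr.
by rewrite big_nat_recr //= IHn exprS; field.
Qed.

(** For i >= N, e^i = e^N e^(i-N) <= e^N 2^N 2^(-i), so u is dominated by a geometric sequence of
    ratio 1/2. *)
Lemma l2norm_le_geometric (u : R^nat) (N : nat) (M e : R) : 0 <= M ->
  0 < e -> e <= 2^-1 -> (forall i, (i < N)%N -> u i = 0) ->
  (forall i, `|u i| <= M * e ^+ i) ->
  (l2norm u <= (2 * M * 2 ^+ N * e ^+ N)%:E)%E.
Proof.
move=> M0 e0 e2 uN uM.
pose D := M * 2 ^+ N * e ^+ N.
have eN0 : 0 <= e ^+ N by rewrite exprn_ge0 // ltW.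
have D0 : 0 <= D by rewrite !mulr_ge0 // exprn_ge0 // ltW.
have uD i : `|u i| <= D * 2^-1 ^+ i.
  have [iN|Ni] := ltnP i N.
    by rewrite uN // normr0 mulr_ge0 // exprn_ge0 // invr_ge0.
  apply: le_trans (uM i) _; rewrite /D -!mulrA ler_wpM2l //.
  rewrite -{1}(subnKC Ni) exprD mulrCA ler_wpM2l ?exprn_ge0 ?(ltW e0) //.
  rewrite -{2}(subnKC Ni) exprD mulrA -exprMn divff // expr1n mul1r.
  by rewrite lerXn2r // ?nnegrE ?(ltW e0) // invr_ge0.
(* One of the two factors 2^(-i) is bounded by 1; the squares then sum to at most 2 D^2 <= (2
   D)^2. *)
have u2 i : `|u i| ^+ 2 <= D ^+ 2 * 2^-1 ^+ i.
  apply: (@le_trans _ _ ((D * 2^-1 ^+ i) ^+ 2)).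
    by rewrite lerXn2r ?nnegrE // mulr_ge0 // exprn_ge0 // invr_ge0.
  rewrite exprMn ler_wpM2l ?sqr_ge0 // expr2 ler_piMl ?exprn_ge0 ?invr_ge0 //.
  by rewrite exprn_ile1 ?invr_ge0 // invf_le1 // ler1n.
have -> : (2 * M * 2 ^+ N * e ^+ N)%:E = (((2 * D) ^+ 2)%:E `^ 2^-1)%E.
  rewrite poweR_EFin powR12_sqrt ?sqr_ge0 // sqrtr_sqr ger0_norm ?mulr_ge0 //.
  by rewrite /D !mulrA.
have -> : l2norm u = ((\sum_(0 <= i <oo) `|(u i)%:E| `^ 2) `^ 2^-1)%E.
  exact: (@Lnorm_counting _ 2 (EFin \o u)).
apply: gt0_ler_poweR; rewrite ?invr_ge0 // ?in_itv /= ?leey ?andbT.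
- by apply: nneseries_ge0 => i _ _; rewrite lee_fin powR_ge0.
- by rewrite lee_fin sqr_ge0.
apply: lime_le; first by apply: is_cvg_nneseries => i _ _; rewrite lee_fin powR_ge0.
apply: nearW => n.
apply: (@le_trans _ _ (\sum_(0 <= i < n) (D ^+ 2 * 2^-1 ^+ i)%:E)%E).
  apply: lee_sum => i _.
  by rewrite lee_fin powR_mulrn.
rewrite sumEFin lee_fin -mulr_sumr.
apply: le_trans (ler_wpM2l (sqr_ge0 D) (geometric_half_sum n)) _.
by rewrite [leRHS]exprMn; have := sqr_ge0 D; lra.
Qed.

End Profile.

(** * The scaling argument and the failure of Hoelder bounds *)

Section Scaling.
Context {R : realType}.

Lemma scaled_profiles (k N : nat) : exists a b : R, [/\ 0 < a, 0 < b
  & forall e, 0 < e -> e <= 2^-1 -> exists x : R -> R,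
      [/\ Sobolev k x, (Sobolev_norm k x <= 1)%E,
          ((a * e ^+ k.+1)%:E <= L2norm x)%E
        & (l2norm (moments x) <= (b * e ^+ N)%:E)%E]].
Proof.
have [p [p0 pk pN]] := @exists_profile R k N.
have [K K0 pK] := derivn_bounded01 p k.
have [y1 [y2 [c [y10 y12 y21 c0 pc]]]] := horner_away0 p0.
(* With lam K = 1/(k + 1), the k + 1 terms of the squared Sobolev norm sum to at most 1. *)
pose lam := (K * k.+1%:R)^-1.
have lam0 : 0 < lam by rewrite invr_gt0 mulr_gt0.
have lamK : lam * K = k.+1%:R^-1.
  by rewrite /lam invfM mulrAC mulVf ?mul1r // gt_eqF.
have s0 : 0 < Num.sqrt (y2 - y1) by rewrite sqrtr_gt0 subr_gt0.
exists (lam * c * Num.sqrt (y2 - y1)), (2 * (lam * K) * 2 ^+ N); split.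
- by rewrite !mulr_gt0.
- by rewrite !mulr_gt0 // exprn_gt0.
move=> e e0 e2.
have e1 : e <= 1 by lra.
have ek1 n : 0 <= e ^+ n <= 1 by rewrite exprn_ge0 ?exprn_ile1 ?(ltW e0).
(* [F n] is the n-th derivative of [F 0]: each differentiation costs a factor 1/e, which e^k
   compensates as long as n <= k. *)
pose F n t := lam * e ^+ k * (- e^-1) ^+ n * (derivn n p).[hat e t].
have cF n : continuous (F n).
  move=> t; apply: cvgM; first exact: cvg_cst.
  exact: continuous_horner_hat.
have dF n : (n < k)%N -> forall t : R, is_derive t 1 (F n) (F n.+1 t).
  move=> nk t.
  have p1 : (derivn n p)`_1 = 0 by rewrite coef_derivn addn1 pk ?mul0rn.
  have := is_deriveZ (lam * e ^+ k * (- e^-1) ^+ n) (is_derive_horner_hat e t p1).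
  by rewrite /F exprSr derivnS /GRing.scale /= !mulrA.
have FK n t : (n <= k)%N -> 0 < t < 1 -> `|F n t| <= lam * K.
  move=> nk /andP[t0 t1].
  have p1 : `|(derivn n p).[hat e t]| <= K.
    by apply: pK => //; rewrite hat_ge0 hat_le1 // ltW.
  have ekn : e ^+ k * e^-1 ^+ n = e ^+ (k - n).
    by rewrite -{1}(subnK nk) exprD -mulrA -exprMn divff ?gt_eqF // expr1n mulr1.
  have -> : `|F n t| = lam * (e ^+ (k - n) * `|(derivn n p).[hat e t]|).
    rewrite -ekn /F !normrM (gtr0_norm lam0) !normrX normrN normfV.
    by rewrite (gtr0_norm e0) !mulrA.
  have /andP[ekn0 ekn1] := ek1 (k - n)%N.
  by rewrite ler_pM2l // -[leRHS]mul1r ler_pM.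
have F0 t : F 0 t = lam * e ^+ k * p.[hat e t] by rewrite /F expr0 mulr1 derivn0.
have mF : measurable_fun setT (F 0) by exact: continuous_measurable_fun.
exists (F 0); split.
- by apply: Sobolev_classical.
- apply: (@Sobolev_norm_classical_le1 _ k F _ _ (lam * K)) => //.
    by rewrite mulr_ge0 // ltW.
  rewrite lamK expr2 mulrA divff ?mul1r ?invf_le1 ?ler1n //.
(* For t in [e (1 - y2), e (1 - y1)], [hat e t] runs through [y1, y2], where |p| >= c. The resulting
   order e^(k+1/2) is weakened to the integer power e^(k+1), using e <= 1. *)
- have eb : Num.sqrt (e * (1 - y1) - e * (1 - y2)) = Num.sqrt e * Num.sqrt (y2 - y1).
    by rewrite -sqrtrM ?(ltW e0) //; congr Num.sqrt; ring.
  apply: (@le_trans _ _ (lam * e ^+ k * c *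
      Num.sqrt (e * (1 - y1) - e * (1 - y2)))%:E).
    rewrite lee_fin eb exprSr.
    have -> : lam * c * Num.sqrt (y2 - y1) * (e ^+ k * e) =
      (lam * e ^+ k * c * Num.sqrt (y2 - y1)) * e by ring.
    have -> : lam * e ^+ k * c * (Num.sqrt e * Num.sqrt (y2 - y1)) =
      (lam * e ^+ k * c * Num.sqrt (y2 - y1)) * Num.sqrt e by ring.
    rewrite ler_wpM2l //.
      rewrite !mulr_ge0 ?sqrtr_ge0 ?(ltW lam0) ?(ltW c0) //.
      by have /andP[] := ek1 k.
    rewrite -{1}(ger0_norm (ltW e0)) -sqrtr_sqr ler_wsqrtr // expr2.
    by rewrite ler_piMl // ltW.
  have ek0 : 0 < e ^+ k by rewrite exprn_gt0.
  apply: L2norm_ge => //.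
  + by rewrite !mulr_ge0 // ltW.
  + by rewrite mulr_gt0 // subr_gt0.
  + by rewrite ltr_pM2l // ltrD2l ltrN2.
  + nra.
  move=> t /andP[t1 t2].
  rewrite F0 normrM gtr0_norm ?mulr_gt0 // ler_pM2l ?mulr_gt0 // hatE //; last nra.
  apply: pc; apply/andP; split.
    by rewrite lerBrDl -lerBrDr ler_pdivrMr // mulrC.
  by rewrite lerBlDl -lerBlDr ler_pdivlMr // mulrC.
apply: l2norm_le_geometric => //.
- by rewrite mulr_ge0 // ltW.
- move=> i iN; rewrite /moments.
  under eq_Rintegral do rewrite F0 mulrCA.
  rewrite RintegralZl // ?pN ?mulr0 //.
  apply: (@continuous_integrable01 _ (fun t => t ^+ i * p.[hat e t])).
  by apply: continuous_mul; [exact: exprn_continuous|exact: continuous_horner_hat].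
move=> i; rewrite /moments; apply: normr_Rintegral01_le.
  by apply: continuous_mul; [exact: exprn_continuous|exact: cF].
move=> t t01; have /andP[t0 t1] := t01; rewrite normrM mulrC.
(* Up to e, t^i <= e^i; beyond e the function vanishes because p(0) = 0. *)
have [te|et] := leP t e.
  apply: ler_pM => //; first exact: FK.
  by rewrite normrX (gtr0_norm t0) lerXn2r ?nnegrE ?(ltW t0) ?(ltW e0).
rewrite F0 hat_eq0 ?(ltW et) // horner_coef0 pk // mulr0 normr0 mul0r.
by rewrite mulr_ge0 ?mulr_ge0 ?(ltW lam0) ?(ltW K0) //; have /andP[] := ek1 i.
Qed.

(** Working with an upper bound delta = b e^N of the norm of the moments makes delta positive and
    explicit, and serves both halves of the theorem. *)
Lemma exists_above_Hoelder (k : nat) (mu C d : R) : 0 < mu -> 0 < C -> 0 < d ->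
  exists (x : R -> R) (delta : R), [/\ 0 < delta < d, Sobolev k x,
    (Sobolev_norm k x <= 1)%E, (l2norm (moments x) <= delta%:E)%E
    & ((C * delta `^ mu)%:E < L2norm x)%E].
Proof.
move=> mu0 C0 d0.
(* As N mu >= k + 2, delta^mu <= b^mu e^(k+2), one power of e below the lower bound a e^(k+1). *)
pose N := (Num.truncn (k.+2%:R / mu)).+1.
have Nmu : k.+2%:R <= N%:R * mu.
  by rewrite -ler_pdivrMr // ltW // truncnS_gt.
have [a [b [a0 b0 h]]] := scaled_profiles k N.
have bmu0 : 0 < C * b `^ mu by rewrite mulr_gt0 // powR_gt0.
(* The three bounds serve [scaled_profiles], the comparison of constants, and delta < d; the last
   two are halved to make these inequalities strict. *)
pose e := Num.min 2^-1 (Num.min (a / (C * b `^ mu) / 2) (d / b / 2)).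
have e0 : 0 < e by rewrite !lt_min invr_gt0 ltr0n !divr_gt0.
have e2 : e <= 2^-1 by rewrite ge_min lexx.
have ea : e < a / (C * b `^ mu).
  apply: (@le_lt_trans _ _ (a / (C * b `^ mu) / 2)).
    by rewrite !ge_min lexx orbT.
  by rewrite ltr_pdivrMr // ltr_pMr ?divr_gt0 // ltr1n.
have ed : e < d / b.
  apply: (@le_lt_trans _ _ (d / b / 2)); first by rewrite !ge_min lexx !orbT.
  by rewrite ltr_pdivrMr // ltr_pMr ?divr_gt0 // ltr1n.
have e1 : e <= 1 by apply: le_trans e2 _; lra.
have [x [xk x1 xa xb]] := h e e0 e2.
exists x, (b * e ^+ N); split => //.
- rewrite mulr_gt0 ?exprn_gt0 //=.
  apply: (@le_lt_trans _ _ (b * e)).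
    by rewrite ler_pM2l // /N exprS ler_piMr ?(ltW e0) // exprn_ile1 // ltW.
  by rewrite mulrC -ltr_pdivlMr.
apply: lt_le_trans xa; rewrite lte_fin.
rewrite powRM ?(ltW b0) ?exprn_ge0 ?(ltW e0) // mulrA.
apply: (@le_lt_trans _ _ (C * b `^ mu * e ^+ k.+2)).
  rewrite ler_pM2l // -!powR_mulrn ?(ltW e0) // -powRrM.
  by apply: ger_powR => //; rewrite e0.
rewrite [e ^+ k.+2]exprS mulrA ltr_pM2r ?exprn_gt0 //.
by rewrite mulrC -ltr_pdivlMr.
Qed.

(** The term n = 0 of the sum. It bounds [modulus] by 1. *)
Lemma L2norm_le_Sobolev_norm (k : nat) (x : R -> R) :
  (L2norm x <= Sobolev_norm k x)%E.
Proof.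
have -> : L2norm x = ((L2norm x ^+ 2) `^ 2^-1)%E.
  by rewrite poweR12_sqrt ?sqre_ge0 // sqrte_sqr gee0_abs // L2norm_ge0.
apply: gt0_ler_poweR; rewrite ?invr_ge0 // ?in_itv /= ?leey ?andbT ?sqre_ge0 //.
  by apply: sume_ge0 => n _; exact: sqre_ge0.
by rewrite big_ord_recl /= leeDl // sume_ge0 // => n _; exact: sqre_ge0.
Qed.

End Scaling.

Theorem proposition13 (R : realType) :
  (forall (mu C : R) (k : nat), 0 < mu < 1 -> 0 < C -> (1 <= k)%N ->
     exists x : R -> R,
       [/\ Sobolev k x, (0 < L2norm x)%E, (Sobolev_norm k x <= 1)%E
         & (C%:E * l2norm (moments x) `^ mu <= L2norm x)%E])
  /\
  (forall (k : nat) (mu : R), (1 <= k)%N -> 0 < mu ->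
     ~ ((fun delta : R => fine (modulus k delta))
          =O_ (0^'+) (fun delta : R => delta `^ mu))).
Proof.
split=> [mu C k /andP[mu0 _] C0 _|k mu _ mu0].
  have [x [delta [/andP[d0 _] xk x1 xd xC]]] :=
    exists_above_Hoelder k mu0 C0 ltr01.
  exists x; split => //.
    by apply: le_lt_trans xC; rewrite lee_fin mulr_ge0 ?powR_ge0 // ltW.
  apply: le_trans (ltW xC).
  rewrite EFinM -poweR_EFin lee_pmul2l ?lte_fin //.
  apply: gt0_ler_poweR => //; first exact: ltW.
    by rewrite in_itv /= leey andbT; exact: Lnorm_ge0.
  by rewrite in_itv /= leey andbT lee_fin ltW.
(* A bound with constant K on ]0, r[ is contradicted at the delta < r obtained for C = K. *)
move=> /eqO_exP[K K0] [r /= r0 hr].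
have [x [delta [/andP[d0 dr] xk x1 xd xC]]] := exists_above_Hoelder k mu0 K0 r0.
have := hr delta; rewrite /= sub0r normrN (gtr0_norm d0) => /(_ dr d0).
apply/negP; rewrite -ltNge (ger0_norm (powR_ge0 _ _)).
have xm : (L2norm x <= modulus k delta)%E by apply: ereal_sup_ubound; exists x.
have m1 : (modulus k delta <= 1)%E.
  apply: ge_ereal_sup => _ [y [_ y1 _] <-].
  exact: le_trans (L2norm_le_Sobolev_norm k y) y1.
have m0 : (0 <= modulus k delta)%E by apply: le_trans xm; exact: L2norm_ge0.
(* Finiteness ensures that [fine] returns the true supremum and not its default value 0. *)
have mfin : modulus k delta \is a fin_num.
  by rewrite ge0_fin_numE // (le_lt_trans m1) // ltry.
apply: lt_le_trans (ler_norm _).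
by rewrite -lte_fin fineK //; exact: lt_le_trans xm.
Qed.
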